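(* Let $(X,\theta,G)$ be a discrete partial dynamical system, and for every $\theta$-invariant $\theta$-admissible subset $Y$ of $X$ let $\mathcal{I}(Y)$ be the ideal of $C^*(X,\theta,G)$ generated by the set $$\{\phi_{(X,\theta,G)}(A)\mid A\in\mathcal{B}(X,\theta,G),\ A\subseteq Y\}.$$ Then the map $Y\mapsto\mathcal{I}(Y)$ is an injective order preserving (i.e., $Y\subseteq Z\Rightarrow\mathcal{I}(Y)\subseteq\mathcal{I}(Z)$) map from the set of $\theta$-invariant $\theta$-admissible subsets of $X$ to the set of ideals of $C^*(X,\theta,G)$.
   Context: Ideals are closed two-sided ideals. A partial action $\theta$ of a group $G$ (neutral element $e$) on a set $X$ is a pair $((D_g)_{g\in G},(\theta_g)_{g\in G})$ with $D_g\subseteq X$ (the domains) and $\theta_g:D_{g^{-1}}\to D_g$ bijections such that for all $h,i\in G$: $D_e=X$ and $\theta_e=\mathrm{Id}_X$; $\theta_h(D_i)=D_h\cap D_{hi}$; $\theta_h(\theta_i(x))=\theta_{hi}(x)$ for $x\in D_{i^{-1}}\cap D_{i^{-1}h^{-1}}$. Here $\theta_g(A)$ means $\theta_g(A\cap D_{g^{-1}})$ for $A\subseteq X$. The triple $(X,\theta,G)$ is a discrete partial dynamical system. $\mathcal{B}(X,\theta,G)$ is the Boolean algebra of subsets of $X$ generated by $\{D_g\mid g\in G\}$. $C^*(X,\theta,G)$ is the universal $C^*$-algebra generated by a family $(s_g)_{g\in G}$ (its generators) such that: (i) the $s_g$ are partial isometries with commuting range projections; (ii) $s_e=1$; (iii)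 $s_{g^{-1}}=s_g^*$ for all $g$; (iv) $s_hs_i=s_hs_h^*s_{hi}$ for all $h,i$; (v) the map $D_g\mapsto s_gs_g^*$ extends to a Boolean homomorphism from $\mathcal{B}(X,\theta,G)$ to the Boolean algebra of projections (with $p\wedge q=pq$, $p\vee q=p+q-pq$, $\neg p=1-p$) of the unital abelian $C^*$-algebra $C^*(\{s_gs_g^*\mid g\in G\})$. A Boolean homomorphism is a map preserving $\wedge,\vee,\neg$. The (unique) Boolean homomorphism in (v) is denoted $\phi_{(X,\theta,G)}$. A subset $Y\subseteq X$ is $\theta$-invariant if $\theta_g(Y)\subseteq Y$ for all $g\in G$, and $\theta$-admissible if $Y=\bigcup\{A\in\mathcal{B}(X,\theta,G)\mid A\subseteq Y\}$. *)

(* Defs.v *)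
From HB Require Import structures.
From mathcomp Require Import all_boot all_order all_algebra.
From mathcomp Require Import all_classical all_reals all_analysis.
From mathcomp Require Import complex.

Set Implicit Arguments.
Unset Strict Implicit.
Unset Printing Implicit Defensive.

Import Order.TTheory GRing.Theory Num.Theory.
Import numFieldNormedType.Exports.

Local Open Scope classical_set_scope.
Local Open Scope ring_scope.

(* Unital C*-algebras. The multiplication is part of this mixin, and the ring
   structure is attached to it just below, because a common subclass of
   CompleteNormedModule and GRing.PzRing is rejected by HB (Num.NumDomain would
   lack a join), while algType excludes the zero algebra: when X is empty,
   C*(X, theta, G) = 0. Norms take their values in R[i], as for any
   normedModType R[i]. *)
HB.mixin Record isCStarAlgebra (R : realType) A
    & CompleteNormedModule R[i] A := {
  cstar_one : A;
  cstar_mul : A -> A -> A;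
  star : A -> A;
  cstar_mulA : associative cstar_mul;
  cstar_mul1 : left_id cstar_one cstar_mul;
  cstar_mulr1 : right_id cstar_one cstar_mul;
  cstar_mulDl : left_distributive cstar_mul +%R;
  cstar_mulDr : right_distributive cstar_mul +%R;
  cstar_scaleAl : forall (k : R[i]) x y,
    k *: cstar_mul x y = cstar_mul (k *: x) y;
  cstar_scaleAr : forall (k : R[i]) x y,
    k *: cstar_mul x y = cstar_mul x (k *: y);
  starK : involutive star;
  starD : {morph star : x y / x + y};
  starZ : forall (k : R[i]) x, star (k *: x) = k^* *: star x;
  starM : forall x y, star (cstar_mul x y) = cstar_mul (star y) (star x);
  cstar_normM : forall x y, `|cstar_mul x y| <= `|x| * `|y|;
  cstar_normE : forall x, `|cstar_mul (star x) x| = `|x| ^+ 2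
}.

#[short(type="cstarType")]
HB.structure Definition CStarAlgebra (R : realType) :=
  {A of isCStarAlgebra R A & CompleteNormedModule R[i] A}.

HB.instance Definition _ (R : realType) (A : cstarType R) :=
  GRing.Zmodule_isPzRing.Build (CStarAlgebra.sort A)
    cstar_mulA cstar_mul1 cstar_mulr1 cstar_mulDl cstar_mulDr.

Section CStarNotions.
Context {R : realType} {A : cstarType R}.

Definition is_cstar_subalgebra (S : set A) : Prop :=
  [/\ closed S, S 0,
      forall (k : R[i]) x y, S x -> S y -> S (k *: x + y),
      forall x y, S x -> S y -> S (x * y)
    & forall x, S x -> S (star x)].

Definition cstar_generated (S : set A) : set A := smallest is_cstar_subalgebra S.

Definition is_closed_ideal (I : set A) : Prop :=
  [/\ closed I, I 0,
      forall (k : R[i]) x y, I x -> I y -> I (k *: x + y),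
      forall a x, I x -> I (a * x)
    & forall a x, I x -> I (x * a)].

Definition ideal_generated (S : set A) : set A := smallest is_closed_ideal S.

Definition is_partial_isometry (a : A) : Prop := a * star a * a = a.

Definition projections_in (S : set A) : set A :=
  [set p | [/\ S p, star p = p & p * p = p]].

End CStarNotions.

(* theta_g is a total function on X whose values outside D_{g^-1} are
   irrelevant: every condition below restricts it to that domain. *)
Record partial_action (X : Type) (G : groupType) := PartialAction {
  dom : G -> set X;
  act : G -> X -> X;
  act_bij : forall g, set_bij (dom g^-1%g) (dom g) (act g);
  dom1 : dom 1%g = setT;
  act1 : forall x, act 1%g x = x;
  act_dom : forall h i,
    act h @` (dom i `&` dom h^-1%g) = dom h `&` dom (h * i)%g;
  actM : forall h i x, (dom i^-1%g `&` dom (i^-1 * h^-1)%g) x ->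
    act h (act i x) = act (h * i)%g x
}.

Section PartialDynamicalSystem.
Context {X : Type} {G : groupType} (theta : partial_action X G).

Definition is_set_boolean_algebra (F : set (set X)) : Prop :=
  [/\ F setT, forall U V, F U -> F V -> F (U `&` V),
      forall U V, F U -> F V -> F (U `|` V) & forall U, F U -> F (~` U)].

Definition domain_algebra : set (set X) :=
  smallest is_set_boolean_algebra (range (dom theta)).

Definition act_image (g : G) (Y : set X) : set X :=
  act theta g @` (Y `&` dom theta g^-1%g).

Definition invariant (Y : set X) : Prop := forall g, act_image g Y `<=` Y.

Definition admissible (Y : set X) : Prop :=
  Y = \bigcup_(U in [set U | domain_algebra U /\ U `<=` Y]) U.

Definition invariant_admissible : set (set X) :=
  [set Y | invariant Y /\ admissible Y].

Section Families.
Context {R : realType} {A : cstarType R}.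

Definition range_proj (s : G -> A) (g : G) : A := s g * star (s g).

(* phi extends D_g |-> s_g s_g^* to a Boolean homomorphism from the algebra
   generated by the D_g to the projections of C*({s_g s_g^*}). Only the values
   of phi on domain_algebra matter. *)
Record extends_to_boolean_hom (s : G -> A) (phi : set X -> A) : Prop := {
  bool_hom_fun : set_fun domain_algebra
    (projections_in (cstar_generated (range (range_proj s)))) phi;
  bool_hom_dom : forall g, phi (dom theta g) = range_proj s g;
  bool_homI : forall U V, domain_algebra U -> domain_algebra V ->
    phi (U `&` V) = phi U * phi V;
  bool_homU : forall U V, domain_algebra U -> domain_algebra V ->
    phi (U `|` V) = phi U + phi V - phi U * phi V;
  bool_homC : forall U, domain_algebra U -> phi (~` U) = 1 - phi U
}.

Record satisfies_relations (s : G -> A) : Prop := {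
  rel_partial_isometry : forall g, is_partial_isometry (s g);
  rel_commute : forall g h,
    range_proj s g * range_proj s h = range_proj s h * range_proj s g;
  rel_one : s 1%g = 1;
  rel_inv : forall g, s g^-1%g = star (s g);
  rel_mul : forall h i, s h * s i = s h * star (s h) * s (h * i)%g;
  rel_bool : exists phi, extends_to_boolean_hom s phi
}.

End Families.

(* (A, s) is the universal C*-algebra C*(X, theta, G) with its generators. The
   *-homomorphism f is unique since A is generated by s; it preserves 1 since
   s_e = 1 and t_e = 1. *)
Record is_universal_cstar {R : realType} {A : cstarType R} (s : G -> A)
    : Prop := {
  univ_rel : satisfies_relations s;
  univ_gen : cstar_generated (range s) = setT;
  univ_map : forall (B : cstarType R) (t : G -> B), satisfies_relations t ->
    exists f : {linear A -> B},
      [/\ {morph f : x y / x * y}, {morph f : x / star x >-> star x}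
        & forall g, f (s g) = t g]
}.

Definition ideal_of {R : realType} {A : cstarType R} (phi : set X -> A)
    (Y : set X) : set A :=
  ideal_generated (phi @` [set U | domain_algebra U /\ U `<=` Y]).

End PartialDynamicalSystem.

(* Main.v *)
(* Given an invariant Z, G acts by partial shifts on the Hilbert space of
   square-summable functions on X vanishing on Z. These shifts satisfy the
   relations of C*(X, theta, G), the Boolean homomorphism being U |-> the
   multiplication by the indicator of U, which vanishes if and only if U lies in
   Z. The induced representation f therefore kills the generators of I(Z). Its
   kernel is closed: if b^* b is small, then 1 - b^* b has a self-adjoint square
   root, whence |f(b) x| <= |x|. So I(Z) lies in the kernel of f, and
   I(Y) = I(Z) forces U in Z for every U in the domain algebra with U in Y,
   that is Y in Z when Y is admissible. *)
Require Import Defs.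
From HB Require Import structures.
From mathcomp Require Import all_boot all_order all_algebra.
From mathcomp Require Import all_classical all_reals all_analysis.
From mathcomp Require Import complex finmap summability ring lra.

Set Implicit Arguments.
Unset Strict Implicit.
Unset Printing Implicit Defensive.

Import Order.TTheory GRing.Theory Num.Theory.
Import numFieldNormedType.Exports.

Local Open Scope classical_set_scope.
Local Open Scope ring_scope.

(** The universal property only speaks of targets of type [cstarType R], so a full C*-algebra of
    operators has to be built, with norm, completeness and adjoint. If Z = X it is the zero algebra,
    which that type allows. Invariance of Z enters through inverses: a point y of Z in D_g is moved
    by g^-1 into Z, so a shifted function still vanishes on Z. The map [f] that the universal
    property yields comes without continuity, whereas ideals are closed: a norm bound has to be
    proved from the algebra alone. The square root replaces spectral theory: 1 - h is the square of
    1 - y as soon as y = (h + y^2)/2, and such a y is reached by iteration from 0 when h is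
    small. *)

Local Notation Re := complex.Re.
Local Notation Im := complex.Im.
Local Notation "r %:C" := (real_complex _ r) : ring_scope.

(** * Hilbert spaces *)

(* Completeness is stated for sequences with a geometric Cauchy rate, with the
   same rate for the limit, so that no topology on H is needed. *)
HB.mixin Record isHilbert (R : realType) H & GRing.Lmodule R[i] H := {
  ip : H -> H -> R[i];
  ipDl : forall x y z, ip (x + y) z = ip x z + ip y z;
  ipZl : forall k x y, ip (k *: x) y = k * ip x y;
  ipC : forall x y, ip y x = (ip x y)^*;
  ip_gt0 : forall x, x != 0 -> 0 < ip x x;
  ip_complete : forall (u : nat -> H) (c : R), 0 <= c ->
    (forall n m, (n <= m)%N ->
      Re (ip (u n - u m) (u n - u m)) <= (c / 2 ^+ n) ^+ 2) ->
    exists l, forall n, Re (ip (u n - l) (u n - l)) <= (c / 2 ^+ n) ^+ 2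
}.

#[short(type="hilbertType")]
HB.structure Definition Hilbert (R : realType) :=
  {H of isHilbert R H & GRing.Lmodule R[i] H}.

Section HilbertTheory.
Context {R : realType} {H : hilbertType R}.
Implicit Types (x y z : H) (k : R[i]).

Lemma ip0l y : ip 0 y = 0.
Proof. by rewrite -(scale0r (0 : H)) ipZl mul0r. Qed.

Lemma ipNl x y : ip (- x) y = - ip x y.
Proof. by rewrite -scaleN1r ipZl mulN1r. Qed.

Lemma ipBl x y z : ip (x - y) z = ip x z - ip y z.
Proof. by rewrite ipDl ipNl. Qed.

Lemma ipDr x y z : ip x (y + z) = ip x y + ip x z.
Proof. by rewrite ipC ipDl rmorphD /= -!ipC. Qed.

Lemma ipZr k x y : ip x (k *: y) = k^* * ip x y.
Proof. by rewrite ipC ipZl rmorphM /= -ipC. Qed.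

Lemma ip0r x : ip x 0 = 0.
Proof. by rewrite ipC ip0l conjC0. Qed.

Lemma ipNr x y : ip x (- y) = - ip x y.
Proof. by rewrite ipC ipNl rmorphN /= -ipC. Qed.

Lemma ipBr x y z : ip x (y - z) = ip x y - ip x z.
Proof. by rewrite ipDr ipNr. Qed.

Lemma ip_ge0 x : 0 <= ip x x.
Proof. by have [->|/ip_gt0/ltW//] := eqVneq x 0; rewrite ip0l. Qed.

Lemma ip_inj x y : (forall z, ip x z = ip y z) -> x = y.
Proof.
move=> e; apply/eqP; rewrite -subr_eq0; apply/negPn/negP => /ip_gt0.
by rewrite ipBl e subrr ltxx.
Qed.

Definition nrm x : R := Num.sqrt (Re (ip x x)).

Lemma nrm_ge0 x : 0 <= nrm x. Proof. exact: sqrtr_ge0. Qed.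

Lemma Re_ip_ge0 x : 0 <= Re (ip x x).
Proof. by have := ip_ge0 x; rewrite lecE => /andP[]. Qed.

Lemma sqr_nrm x : nrm x ^+ 2 = Re (ip x x).
Proof. by rewrite sqr_sqrtr // Re_ip_ge0. Qed.

Lemma ip_nrm x : ip x x = (nrm x ^+ 2)%:C.
Proof. by rewrite sqr_nrm RRe_real // ger0_real // ip_ge0. Qed.

Lemma nrm0 : nrm 0 = 0.
Proof. by rewrite /nrm ip0l sqrtr0. Qed.

Lemma nrm_eq0 x : nrm x = 0 -> x = 0.
Proof.
move=> e; apply/eqP/negPn/negP => /ip_gt0.
by rewrite ip_nrm e expr0n /= ltxx.
Qed.

Lemma nrmZ k x : (nrm (k *: x))%:C = `|k| * (nrm x)%:C.
Proof.
have p : 0 <= `|k| * (nrm x)%:C by apply: mulr_ge0; rewrite // ler0c nrm_ge0.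
have q : 0 <= (nrm (k *: x))%:C by rewrite ler0c nrm_ge0.
apply/eqP; rewrite -(eqrXn2 (isT : (0 < 2)%N) q p); apply/eqP.
rewrite exprMn -[LHS]rmorphXn -[X in _ * X]rmorphXn /= -!ip_nrm.
by rewrite ipZl ipZr mulrA -normCK.
Qed.

Lemma nrmN x : nrm (- x) = nrm x.
Proof. by rewrite /nrm ipNl ipNr opprK. Qed.

Lemma CauchySchwarz_ip x y : `|ip x y| <= (nrm x * nrm y)%:C.
Proof.
have p : 0 <= (nrm x * nrm y)%:C by rewrite ler0c mulr_ge0 ?nrm_ge0.
rewrite -(ler_pXn2r (isT : (0 < 2)%N) (normr_ge0 _) p).
rewrite -[leRHS]rmorphXn exprMn rmorphM /= -!ip_nrm.
have [->|y0] := eqVneq y 0; first by rewrite !ip0r normr0 expr0n mulr0.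
have yy := ip_gt0 _ y0.
have yyr : (ip y y)^* = ip y y by rewrite -ipC.
(* The component of [x] orthogonal to [y]. *)
have := ip_ge0 (x - (ip x y / ip y y) *: y).
rewrite !(ipBl, ipBr, ipZl, ipZr) rmorphM /= fmorphV /= yyr (ipC x y).
rewrite [X in 0 <= X](_ : _ = ip x x - `|ip x y| ^+ 2 / ip y y).
  by rewrite subr_ge0 ler_pdivrMr.
by rewrite normCK; field; rewrite gt_eqF.
Qed.

Lemma Re_le_normc (z : R[i]) : (Re z)%:C <= `|z|.
Proof. by apply: le_trans (normc_ge_Re z); rewrite lecR ler_norm. Qed.

Lemma Re_ip_le x y : Re (ip x y) <= nrm x * nrm y.
Proof. by rewrite -lecR (le_trans (Re_le_normc _)) // CauchySchwarz_ip. Qed.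

Lemma nrmD x y : nrm (x + y) <= nrm x + nrm y.
Proof.
rewrite -(@ler_pXn2r _ 2) ?nnegrE ?addr_ge0 ?nrm_ge0 //.
rewrite sqrrD !sqr_nrm ipDl !ipDr !raddfD /=.
have -> : Re (ip y x) = Re (ip x y) by rewrite (ipC x y); case: (ip x y).
have := Re_ip_le x y; lra.
Qed.

Lemma nrmB x y : nrm (x - y) <= nrm x + nrm y.
Proof. by rewrite -(nrmN y) nrmD. Qed.

Lemma nrm_complete (u : nat -> H) (c : R) : 0 <= c ->
  (forall n m, (n <= m)%N -> nrm (u n - u m) <= c / 2 ^+ n) ->
  exists l, forall n, nrm (u n - l) <= c / 2 ^+ n.
Proof.
move=> c0 uc; have cn n : 0 <= c / 2 ^+ n by rewrite divr_ge0 // exprn_ge0.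
have [|l lP] := ip_complete u c c0.
  by move=> n m nm; rewrite -sqr_nrm ler_pXn2r ?nnegrE ?nrm_ge0 // uc.
exists l => n.
by rewrite -(@ler_pXn2r _ 2) ?nnegrE ?nrm_ge0 // sqr_nrm.
Qed.

End HilbertTheory.

(** * Completeness from geometric Cauchy rates *)

Section RateComplete.
Context {R : realType}.

Lemma gt0_complex (e : R[i]) : 0 < e -> e = (Re e)%:C /\ 0 < Re e.
Proof.
by case: e => a b; rewrite ltcE /= => /andP[/eqP-> a0].
Qed.

Lemma normC_Re (V : normedZmodType R[i]) (v : V) : `|v| = (Re `|v|)%:C.
Proof. by rewrite RRe_real // normr_real. Qed.

Lemma Re_normr_ge0 (V : normedZmodType R[i]) (v : V) : 0 <= Re `|v|.
Proof. by have := normr_ge0 v; rewrite lecE => /andP[]. Qed.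

Lemma ltr0c (k : R) : (0 < k%:C) = (0 < k).
Proof. exact: ltcR. Qed.

Lemma exists_half_lt (c e : R) : 0 < e -> exists n, c / 2 ^+ n < e.
Proof.
move=> e0; have [n cn] : exists n, c / e < n%:R.
  exists (Num.bound `|c / e|); apply: le_lt_trans (archi_boundP _) => //.
  exact: ler_norm.
exists n; rewrite ltr_pdivrMr ?exprn_gt0 // mulrC -ltr_pdivrMr //.
apply: lt_le_trans cn _; rewrite -natrX ler_nat.
exact/ltnW/ltn_expl.
Qed.

(** Limits come with a geometric rate, so an identity between limits is proved by bounding its
    defect by a constant over 2^n. *)
Lemma le_half (a b c : R) : (forall n, a <= b + c / 2 ^+ n) -> a <= b.
Proof.
move=> h; apply/ler_addgt0Pr => e /(exists_half_lt c)[n ne].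
by apply: le_trans (h n) _; rewrite lerD2l ltW.
Qed.

(** Reduces filters to sequences. Let [u n] be the centre of a ball of radius 2^-n that belongs to
    [F]; two such balls meet, so the centres are at distance at most 2^-n + 2^-m, which is at most 2
    / 2^n for n <= m. *)
Lemma cauchy_cvg_rate (V : normedModType R[i]) :
  (forall u : nat -> V,
    (forall n m, (n <= m)%N -> `|u n - u m| <= (2 / 2 ^+ n)%:C) ->
    exists l, forall n, `|u n - l| <= (2 / 2 ^+ n)%:C) ->
  forall F : set_system V, ProperFilter F -> cauchy F -> cvg F.
Proof.
move=> cV F FF Fc.
move: Fc => /cauchyP Fc.
have {}Fc n : exists x : V, F (ball x ((2 ^+ n)^-1)%:C).
  by apply: Fc; rewrite ltr0c invr_gt0 exprn_gt0.
have [u uP] := choice Fc.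
have [|l lP] := cV u.
  move=> n m nm.
  have [z [nz mz]] := filter_ex (filterI (uP n) (uP m)).
  have -> : u n - u m = (u n - z) - (u m - z) by rewrite opprB addrA subrK.
  apply: le_trans (ler_normB _ _) _.
  move: nz mz; rewrite -!ball_normE /= => /ltW nz /ltW mz.
  apply: le_trans (lerD nz mz) _.
  rewrite -rmorphD lecR.
  have : (2 ^+ m : R)^-1 <= (2 ^+ n)^-1.
    by rewrite lef_pV2 ?posrE ?exprn_gt0 // ler_weXn2l // ler1n.
  by rewrite -mulr_natl => h; lra.
apply/cvg_ex; exists l; apply/cvgrPdist_lt => e e0.
have [eR Re0] := gt0_complex e0.
(* 3 = 1 + 2: the radius of the ball around [u n], plus the distance from [u n] to [l]. *)
have [n ne] := exists_half_lt 3 Re0.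
apply: filterS (uP n) => z; rewrite -ball_normE /= => uz.
have -> : l - z = (u n - z) - (u n - l) by rewrite opprB [RHS]addrC addrA subrK.
apply: le_lt_trans (ler_normB _ _) _.
apply: le_lt_trans (lerD (ltW uz) (lP n)) _.
by rewrite eR -rmorphD ltcR; lra.
Qed.

(** The field is left general: over R this gives the coordinates in [l2_complete], over R[i] the
    limits in a C*-algebra. *)
Lemma cvg_of_rate (K : numFieldType) (V : completeNormedModType K)
    (u : nat -> V) (e : nat -> K) :
  (forall d, 0 < d -> exists n, e n < d) ->
  (forall n m, (n <= m)%N -> `|u n - u m| <= e n) -> cvg (u @ \oo).
Proof.
move=> e0 ue; apply/cauchy_cvgP/cauchy_exP => d /e0[n nd].
exists (u n); exists n => // m /= nm; rewrite -ball_normE /=.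
exact: le_lt_trans (ue _ _ nm) nd.
Qed.

Lemma cvg_rate (V : completeNormedModType R[i]) (u : nat -> V) (c : R) :
  (forall n m, (n <= m)%N -> `|u n - u m| <= (c / 2 ^+ n)%:C) ->
  exists l, forall n, `|u n - l| <= (c / 2 ^+ n)%:C.
Proof.
move=> uc; have : cvg (u @ \oo).
  apply: cvg_of_rate uc => d /gt0_complex[-> /(exists_half_lt c)[n nd]].
  by exists n; rewrite ltcR.
move=> /cvg_ex[l ul]; exists l => n.
rewrite (normC_Re (u n - l)) lecR; apply/ler_addgt0Pr => e e0.
have eC : 0 < e%:C by rewrite ltr0c.
have ul' : \forall m \near \oo, `|l - u m| < e%:C by move/cvgrPdist_lt: ul; apply.
have nm' : \forall m \near \oo, (n <= m)%N by exists n.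
have [m [um nm]] := filter_ex (filterI ul' nm').
rewrite -lecR -normC_Re rmorphD.
have -> : u n - l = (u n - u m) - (l - u m) by rewrite opprB addrA subrK.
by apply: le_trans (ler_normB _ _) _; rewrite lerD // ?uc // ltW.
Qed.

End RateComplete.

(** * The C*-algebra of bounded operators *)

Section BoundedOperators.
Context {R : realType} (H : hilbertType R).

Definition adjoint_to (T T' : H -> H) : Prop :=
  forall x y, ip (T x) y = ip x (T' y).

Definition bounded_by (c : R) (T : H -> H) : Prop :=
  forall x, nrm (T x) <= c * nrm x.

(** Making the adjoint part of the definition avoids the Riesz representation theorem, and linearity
    becomes a consequence, [adjoint_linear]. *)
Definition adjointable : {pred H -> H} := [pred T : H -> H |
  `[< exists T', adjoint_to T T' /\ exists2 c, 0 <= c & bounded_by c T >]].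

Lemma adjointableP (T : H -> H) :
  reflect (exists T', adjoint_to T T' /\ exists2 c, 0 <= c & bounded_by c T)
    (T \in adjointable).
Proof. exact: asboolP. Qed.

Lemma adjoint_sym T T' : adjoint_to T T' -> adjoint_to T' T.
Proof. by move=> a x y; rewrite ipC -a -ipC. Qed.

(** |T' y|^2 = <T (T' y), y> <= c |T' y| |y|; divide by |T' y|. *)
Lemma adjoint_bound T T' (c : R) :
  adjoint_to T T' -> 0 <= c -> bounded_by c T -> bounded_by c T'.
Proof.
move=> a c0 b y; have [y0|y0] := eqVneq (nrm (T' y)) 0.
  by rewrite y0 mulr_ge0 ?nrm_ge0.
have T'0 : 0 < nrm (T' y) by rewrite lt_def y0 nrm_ge0.
rewrite -(ler_pM2r T'0) -expr2 sqr_nrm -a.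
apply: le_trans (Re_ip_le _ _) _.
apply: le_trans (ler_wpM2r (nrm_ge0 _) (b _)) _.
by rewrite mulrAC.
Qed.

Lemma adjoint_linear T T' : adjoint_to T T' -> linear T.
Proof.
by move=> a k x y; apply: ip_inj => z; rewrite a !(ipDl, ipZl) !a.
Qed.

Lemma adjointable_submod : submod_closed adjointable.
Proof.
split=> [|k T S].
  apply/adjointableP; exists (fun=> 0); split => [x y|].
    by rewrite ip0l ip0r.
  by exists 0 => // x; rewrite nrm0 mul0r.
move=> /adjointableP[T' [aT [c c0 bT]]] /adjointableP[S' [aS [d d0 bS]]].
apply/adjointableP; exists (fun y => k^* *: T' y + S' y); split=> [x y|].
  by rewrite ipDl ipZl aT aS ipDr ipZr conjCK.
exists (Re `|k| * c + d) => [|x].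
  by rewrite addr_ge0 // mulr_ge0 // Re_normr_ge0.
apply: le_trans (nrmD _ _) _; rewrite mulrDl lerD //.
rewrite -lecR nrmZ normC_Re -rmorphM lecR -mulrA ler_wpM2l //.
exact: Re_normr_ge0.
Qed.

HB.instance Definition _ :=
  GRing.isSubmodClosed.Build _ _ adjointable adjointable_submod.

Record bop := Bop { bop_fun :> H -> H; bop_adjointable : bop_fun \in adjointable }.

HB.instance Definition _ := [isSub for bop_fun].
HB.instance Definition _ := [Choice of bop by <:].
HB.instance Definition _ := [SubChoice_isSubLmodule of bop by <:].

Implicit Types T S : bop.

Lemma bopP T S : (forall x, T x = S x) -> T = S.
Proof. by move=> e; apply/val_inj/funext. Qed.

Lemma bopD T S x : (T + S) x = T x + S x. Proof. by []. Qed.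

Lemma bopZ k T x : (k *: T) x = k *: T x. Proof. by []. Qed.

Lemma bopB T S x : (T - S) x = T x - S x. Proof. by []. Qed.

Lemma bop0 x : (0 : bop) x = 0. Proof. by []. Qed.

Definition adj_fun T : H -> H := projT1 (cid (adjointableP _ (bop_adjointable T))).

Lemma adj_funP T : adjoint_to T (adj_fun T).
Proof. by rewrite /adj_fun; case: cid => ? []. Qed.

Lemma bop_linear T : linear T.
Proof. exact: adjoint_linear (@adj_funP T). Qed.

Lemma bop_ex_bound T : exists2 c, 0 <= c & bounded_by c T.
Proof. by have /adjointableP[T' []] := bop_adjointable T. Qed.

End BoundedOperators.

(** * The operator norm and its completeness *)

Section OperatorNorm.
Context {R : realType} {H : hilbertType R}.
Implicit Types T S : bop H.

Definition onorm T : R := inf [set c | 0 <= c /\ bounded_by c T].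

Lemma onorm_le T c : 0 <= c -> bounded_by c T -> onorm T <= c.
Proof. by move=> c0 cT; apply: ge_inf => //; exists 0 => d []. Qed.

Lemma onorm_ge0 T : 0 <= onorm T.
Proof.
have [c c0 cT] := bop_ex_bound T.
by apply: lb_le_inf => [|d []//]; exists c.
Qed.

Lemma onormP T : bounded_by (onorm T) T.
Proof.
move=> x; have [c c0 cT] := bop_ex_bound T.
have [x0|x0] := eqVneq (nrm x) 0.
  by rewrite x0 mulr0; apply: le_trans (cT x) _; rewrite x0 mulr0.
have {}x0 : 0 < nrm x by rewrite lt_def x0 nrm_ge0.
rewrite -ler_pdivrMr //; apply: lb_le_inf; first by exists c.
by move=> d [d0 dT]; rewrite ler_pdivrMr.
Qed.

Lemma onormD T S : onorm (T + S) <= onorm T + onorm S.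
Proof.
apply: onorm_le => [|x]; first by rewrite addr_ge0 ?onorm_ge0.
by rewrite bopD mulrDl (le_trans (nrmD _ _)) // lerD ?onormP.
Qed.

Lemma nrmZ_Re (k : R[i]) (x : H) : nrm (k *: x) = Re `|k| * nrm x.
Proof. by apply: complexI; rewrite nrmZ rmorphM. Qed.

Lemma onormZ_le k T : onorm (k *: T) <= Re `|k| * onorm T.
Proof.
apply: onorm_le => [|x]; first by rewrite mulr_ge0 ?onorm_ge0 ?Re_normr_ge0.
by rewrite bopZ nrmZ_Re -mulrA ler_wpM2l ?Re_normr_ge0 ?onormP.
Qed.

Lemma onormZ k T : onorm (k *: T) = Re `|k| * onorm T.
Proof.
apply/eqP; rewrite eq_le onormZ_le andTb.
have [->|k0] := eqVneq k 0; first by rewrite normr0 mul0r onorm_ge0.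
have k1 : Re `|k| * Re `|k^-1| = 1.
  by apply: complexI; rewrite rmorphM -[LHS]/(`|k| * `|k^-1|) -normrM mulfV ?normr1.
have := ler_wpM2l (Re_normr_ge0 k) (onormZ_le k^-1 (k *: T)).
by rewrite mulrA k1 mul1r scalerA mulVf // scale1r.
Qed.

Lemma onorm_eq0 T : onorm T = 0 -> T = 0.
Proof.
move=> T0; apply: bopP => x; apply: nrm_eq0; apply/eqP.
by rewrite eq_le nrm_ge0 andbT (le_trans (onormP T x)) // T0 mul0r.
Qed.

Lemma onormC_D T S : (onorm (T + S))%:C <= (onorm T)%:C + (onorm S)%:C.
Proof. by rewrite -rmorphD lecR onormD. Qed.

Lemma onormC_Z k T : (onorm (k *: T))%:C = `|k| * (onorm T)%:C.
Proof. by rewrite onormZ rmorphM. Qed.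

Lemma onormC_eq0 T : (onorm T)%:C = 0 -> T = 0.
Proof. by move/complexI/onorm_eq0. Qed.

HB.instance Definition _ := Lmodule_isNormed.Build R[i] (bop H)
  onormC_D onormC_Z onormC_eq0.

Lemma normr_bop T : `|T| = (onorm T)%:C. Proof. by []. Qed.

(** By [adjoint_bound] the adjoints satisfy the same Cauchy estimate as the operators. So both
    converge pointwise, and the limit of the adjoints is an adjoint of the limit. *)
Lemma bop_rate_complete (u : nat -> bop H) :
  (forall n m, (n <= m)%N -> `|u n - u m| <= (2 / 2 ^+ n)%:C) ->
  exists l, forall n, `|u n - l| <= (2 / 2 ^+ n)%:C.
Proof.
move=> uc.
have u_cauchy x n m : (n <= m)%N -> nrm (u n x - u m x) <= 2 * nrm x / 2 ^+ n.
  move=> nm; rewrite -bopB (le_trans (onormP _ _)) // mulrAC.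
  by rewrite ler_wpM2r ?nrm_ge0 // -lecR -normr_bop uc.
have u'_cauchy x n m : (n <= m)%N ->
    nrm (adj_fun (u n) x - adj_fun (u m) x) <= 2 * nrm x / 2 ^+ n.
  move=> nm; have a : adjoint_to (u n - u m)
      (fun x => adj_fun (u n) x - adj_fun (u m) x).
    by move=> y z; rewrite bopB ipBl !(adj_funP _) ipBr.
  rewrite (le_trans (adjoint_bound a (onorm_ge0 _) (onormP _) _)) // mulrAC.
  by rewrite ler_wpM2r ?nrm_ge0 // -lecR -normr_bop uc.
have c0 (x : H) : 0 <= 2 * nrm x by rewrite mulr_ge0 ?nrm_ge0.
have [L LP] := choice (fun x : H => nrm_complete (c0 x) (u_cauchy x)).
have [L' L'P] := choice (fun x : H => nrm_complete (c0 x) (u'_cauchy x)).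
have aL : adjoint_to L L'.
  move=> x y; apply/eqP; rewrite -subr_eq0 -normr_eq0.
  rewrite eq_le normr_ge0 andbT (normC_Re (_ - _)) lecR.
  (* 4 = 2 + 2: the operators and their adjoints are each within 2 / 2^n of their limit. *)
  apply: (@le_half _ _ _ (4 * nrm x * nrm y)) => n; rewrite add0r.
  have -> : ip (L x) y - ip x (L' y) =
      ip x (adj_fun (u n) y - L' y) - ip (u n x - L x) y.
    by rewrite ipBl ipBr adj_funP opprB [RHS]addrC addrA subrK.
  rewrite -lecR -normC_Re (le_trans (ler_normB _ _)) //.
  apply: le_trans (lerD (CauchySchwarz_ip _ _) (CauchySchwarz_ip _ _)) _.
  rewrite -rmorphD lecR.
  have := ler_wpM2l (nrm_ge0 x) (L'P y n).
  have := ler_wpM2r (nrm_ge0 y) (LP x n); lra.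
have uL n : bounded_by (2 / 2 ^+ n) (fun x => u n x - L x).
  by move=> x; rewrite mulrAC.
have LA : L \in @adjointable R H.
  apply/adjointableP; exists L'; split=> //.
  exists (onorm (u 0%N) + 2) => [|x]; first by rewrite addr_ge0 ?onorm_ge0.
  have -> : L x = u 0%N x - (u 0%N x - L x) by rewrite opprB addrC subrK.
  rewrite (le_trans (nrmB _ _)) // mulrDl lerD ?onormP //.
  by have := uL 0%N x; rewrite expr0 divr1.
exists (Bop LA) => n; rewrite normr_bop lecR.
by apply: onorm_le; [rewrite divr_ge0 // exprn_ge0 | exact: uL].
Qed.

HB.instance Definition _ := Uniform_isComplete.Build (bop H)
  (cauchy_cvg_rate bop_rate_complete).

End OperatorNorm.

(** * Composition, adjoint and the C*-identity *)

Section OperatorAlgebra.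
Context {R : realType} {H : hilbertType R}.
Implicit Types T S U : bop H.

Lemma adjointable_id : idfun \in @adjointable R H.
Proof.
apply/adjointableP; exists idfun; split=> //.
by exists 1 => // x; rewrite mul1r.
Qed.

Lemma adjointable_comp T S : T \o S \in @adjointable R H.
Proof.
apply/adjointableP; exists (adj_fun S \o adj_fun T); split=> [x y|].
  by rewrite /= !adj_funP.
exists (onorm T * onorm S) => [|x]; first by rewrite mulr_ge0 ?onorm_ge0.
rewrite (le_trans (onormP T (S x))) // -mulrA ler_wpM2l ?onorm_ge0 //.
exact: onormP.
Qed.

Lemma adjointable_adj T : adj_fun T \in @adjointable R H.
Proof.
have a := @adj_funP _ _ T.
apply/adjointableP; exists T; split; first exact: adjoint_sym.
exists (onorm T); first exact: onorm_ge0.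
exact: adjoint_bound a (onorm_ge0 T) (@onormP _ _ T).
Qed.

Definition bop_one : bop H := Bop adjointable_id.
Definition bop_mul T S : bop H := Bop (adjointable_comp T S).
Definition bop_star T : bop H := Bop (adjointable_adj T).

Lemma bop_starP T x y : ip (T x) y = ip x (bop_star T y).
Proof. exact: adj_funP. Qed.

Lemma bop_star_uniq T S : adjoint_to T S -> bop_star T = S.
Proof.
move=> a; apply: bopP => y; apply: ip_inj => z.
by rewrite ipC -bop_starP a -ipC.
Qed.

Lemma onormM T S : onorm (bop_mul T S) <= onorm T * onorm S.
Proof.
apply: onorm_le => [|x]; first by rewrite mulr_ge0 ?onorm_ge0.
rewrite (le_trans (onormP T (S x))) // -mulrA ler_wpM2l ?onorm_ge0 //.
exact: onormP.
Qed.

Lemma onorm_star T : onorm (bop_star T) <= onorm T.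
Proof.
apply: onorm_le; first exact: onorm_ge0.
exact: adjoint_bound (@adj_funP _ _ T) (onorm_ge0 T) (@onormP _ _ T).
Qed.

Lemma onorm_starM T : onorm (bop_mul (bop_star T) T) = onorm T ^+ 2.
Proof.
apply/eqP; rewrite eq_le; apply/andP; split.
  by rewrite (le_trans (onormM _ _)) // expr2 ler_wpM2r ?onorm_ge0 ?onorm_star.
(* Conversely |T x|^2 = <P x, x> <= |P| |x|^2, so the square root of |P| bounds [T]. *)
set P := bop_mul _ _.
rewrite -[leRHS]sqr_sqrtr ?onorm_ge0 // ler_pXn2r ?nnegrE ?sqrtr_ge0 ?onorm_ge0 //.
apply: onorm_le => [|x]; first exact: sqrtr_ge0.
rewrite -(@ler_pXn2r _ 2) ?nnegrE ?mulr_ge0 ?sqrtr_ge0 ?nrm_ge0 //.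
rewrite exprMn (sqr_sqrtr (onorm_ge0 P)) sqr_nrm bop_starP ipC.
have -> : Re (ip (bop_star T (T x)) x)^* = Re (ip (P x) x).
  by rewrite /=; case: (ip _ _).
apply: le_trans (Re_ip_le _ _) _; rewrite expr2 mulrA.
by rewrite ler_wpM2r ?nrm_ge0 ?onormP.
Qed.

Lemma bop_normE T : `|bop_mul (bop_star T) T| = `|T| ^+ 2.
Proof. by rewrite !normr_bop onorm_starM rmorphXn. Qed.

Lemma bop_normM T S : `|bop_mul T S| <= `|T| * `|S|.
Proof. by rewrite !normr_bop -rmorphM lecR onormM. Qed.

Lemma bop_mulA : associative bop_mul.
Proof. by move=> T S U; apply: bopP. Qed.

Lemma bop_mul1 : left_id bop_one bop_mul.
Proof. by move=> T; apply: bopP. Qed.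

Lemma bop_mulr1 : right_id bop_one bop_mul.
Proof. by move=> T; apply: bopP. Qed.

Lemma bop_mulDl : left_distributive bop_mul +%R.
Proof. by move=> T S U; apply: bopP. Qed.

Lemma bop_apD T x y : T (x + y) = T x + T y.
Proof. by have := bop_linear T 1 x y; rewrite !scale1r. Qed.

Lemma bop_apZ T k x : T (k *: x) = k *: T x.
Proof.
have T0 : T 0 = 0 by apply: (addrI (T 0)); rewrite -bop_apD !addr0.
by have := bop_linear T k x 0; rewrite T0 !addr0.
Qed.

Lemma bop_mulDr : right_distributive bop_mul +%R.
Proof. by move=> T S U; apply: bopP => x; exact: bop_apD. Qed.

Lemma bop_scaleAl k T S : k *: bop_mul T S = bop_mul (k *: T) S.
Proof. by apply: bopP. Qed.

Lemma bop_scaleAr k T S : k *: bop_mul T S = bop_mul T (k *: S).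
Proof. by apply: bopP => x; rewrite bopZ [RHS]bop_apZ. Qed.

Lemma bop_starK : involutive bop_star.
Proof. by move=> T; apply/bop_star_uniq/adjoint_sym/adj_funP. Qed.

Lemma bop_starD : {morph bop_star : T S / T + S}.
Proof.
by move=> T S; apply: bop_star_uniq => x y; rewrite !bopD ipDl ipDr !bop_starP.
Qed.

Lemma bop_starZ k T : bop_star (k *: T) = k^* *: bop_star T.
Proof.
by apply: bop_star_uniq => x y; rewrite !bopZ ipZl ipZr conjCK bop_starP.
Qed.

Lemma bop_starM T S : bop_star (bop_mul T S) = bop_mul (bop_star S) (bop_star T).
Proof. by apply: bop_star_uniq => x y; rewrite /= !adj_funP. Qed.

HB.instance Definition _ := isCStarAlgebra.Build R (bop H)
  bop_mulA bop_mul1 bop_mulr1 bop_mulDl bop_mulDr bop_scaleAl bop_scaleAr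
  bop_starK bop_starD bop_starZ bop_starM bop_normM bop_normE.

(* The ring operations of Defs are attached to [CStarAlgebra.sort], so [*] and
   [1] are only found on [bop H] seen as a cstarType. *)
Definition opalg : cstarType R := bop H.

Lemma bopM (T S : opalg) x : (T * S) x = T (S x). Proof. by []. Qed.

Lemma starP (T : opalg) x y : ip (T x) y = ip x (star T y).
Proof. exact: bop_starP. Qed.

Lemma star_uniq (T S : opalg) : adjoint_to T S -> star T = S.
Proof. exact: bop_star_uniq. Qed.

End OperatorAlgebra.
Arguments opalg {R} H.

(** * Square-summable functions *)

Section SquareSummable.
Context {R : realType} {X : choiceType}.

Existing Instance totally_filter.

Definition psum (f : X -> R) (F : {fset X}) : R := \sum_(x <- F) f x.

Definition summable_fun (f : X -> R) : Prop := cvg (psum f @ totally).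

Definition tsum (f : X -> R) : R := lim (psum f @ totally).

Lemma near_totally (F : {fset X}) :
  \forall G \near (@totally X), (F `<=` G)%fset.
Proof. by exists F. Qed.

Lemma le_psum (f : X -> R) (F G : {fset X}) :
  (forall x, 0 <= f x) -> (F `<=` G)%fset -> psum f F <= psum f G.
Proof.
move=> f0 FG; pose g x := if x \in F then f x else 0.
have -> : psum f F = \sum_(x <- F) g x.
  by apply: eq_big_seq => x xF; rewrite /g xF.
rewrite (big_fset_incl _ FG) => [|x _ /negbTE]; last by rewrite /g => ->.
by apply: ler_sum => x _; rewrite /g; case: ifP.
Qed.

Lemma bounded_summable (f : X -> R) (M : R) :
  (forall x, 0 <= f x) -> (forall F, psum f F <= M) -> summable_fun f.
Proof.
move=> f0 fM; pose S := range (psum f).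
have hS : has_sup S.
  by split; [exists (psum f fset0), fset0 | exists M => _ [F _ <-]].
apply/cvg_ex; exists (sup S); apply/cvgrPdist_lt => e e0.
have [_ [F _ <-] SF] := sup_adherent e0 hS.
apply: filterS (near_totally F) => G FG.
have GS : psum f G <= sup S by apply: (ub_le_sup hS.2); exists G.
rewrite ger0_norm ?subr_ge0 // ltrBlDr -ltrBlDl.
exact: lt_le_trans SF (le_psum f0 FG).
Qed.

Lemma psum_le_tsum (f : X -> R) (F : {fset X}) :
  (forall x, 0 <= f x) -> summable_fun f -> psum f F <= tsum f.
Proof.
move=> f0 sf; apply: limr_ge => //.
by apply: filterS (near_totally F) => G; apply: le_psum.
Qed.

Lemma tsum_le (f : X -> R) (M : R) :
  summable_fun f -> (forall F, psum f F <= M) -> tsum f <= M.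
Proof. by move=> sf fM; apply: limr_le => //; apply: filterE. Qed.

Lemma psum0 : psum (fun=> 0) = cst 0.
Proof. by apply/funext => F; rewrite /psum big1. Qed.

Lemma summable0 : summable_fun (fun=> 0).
Proof. by rewrite /summable_fun psum0; exact: is_cvg_cst. Qed.

Lemma tsum0 : tsum (fun=> 0) = 0.
Proof. by rewrite /tsum psum0 lim_cst. Qed.

Lemma cvg_psum_lin (k : R) (f g : X -> R) :
  summable_fun f -> summable_fun g ->
  psum (fun x => k * f x + g x) @ totally --> k * tsum f + tsum g.
Proof.
move=> sf sg.
have -> : psum (fun x => k * f x + g x) = (cst k \* psum f) + psum g.
  by apply/funext => F; rewrite /psum big_split /= -mulr_sumr.
by apply: cvgD => //; apply: cvgM => //; exact: cvg_cst.
Qed.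

Lemma summable_lin (k : R) (f g : X -> R) :
  summable_fun f -> summable_fun g ->
  summable_fun (fun x => k * f x + g x).
Proof. by move=> sf sg; apply/cvg_ex; eexists; exact: cvg_psum_lin. Qed.

Lemma tsum_lin (k : R) (f g : X -> R) :
  summable_fun f -> summable_fun g ->
  tsum (fun x => k * f x + g x) = k * tsum f + tsum g.
Proof. by move=> sf sg; apply: cvg_lim => //; exact: cvg_psum_lin. Qed.

Lemma summableZ (k : R) (f : X -> R) :
  summable_fun f -> summable_fun (fun x => k * f x).
Proof.
move=> sf; rewrite (_ : (fun x => k * f x) = (fun x => k * f x + 0)).
  exact: summable_lin summable0.
by apply/funext => x; rewrite addr0.
Qed.

Lemma tsumZ (k : R) (f : X -> R) :
  summable_fun f -> tsum (fun x => k * f x) = k * tsum f.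
Proof.
move=> sf; rewrite -[RHS]addr0 -tsum0 -(tsum_lin k sf summable0).
by congr tsum; apply/funext => x; rewrite addr0.
Qed.

(** Signed sums reduce to nonnegative ones: 0 <= f + g <= 2 g, and f is the difference of f + g and
    g. *)
Lemma summable_dom (f g : X -> R) :
  (forall x, `|f x| <= g x) -> summable_fun g -> summable_fun f.
Proof.
move=> fg sg; have g0 x : 0 <= g x by apply: le_trans (fg x).
have fgr x := (ler_normlP _ _ (fg x)).
have sfg : summable_fun (fun x => 1 * f x + g x).
  apply: (@bounded_summable _ (2 * tsum g)) => [x|F].
    by have [] := fgr x; lra.
  apply: le_trans (_ : 2 * psum g F <= _); last first.
    by rewrite ler_pM2l ?psum_le_tsum.
  rewrite mulr_sumr; apply: ler_sum => x _; have [] := fgr x; lra.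
rewrite (_ : f = (fun x => -1 * g x + (1 * f x + g x))).
  exact: summable_lin.
by apply/funext => x; lra.
Qed.

End SquareSummable.

Arguments summable_lin {R X} k {f g}.
Arguments summableZ {R X} k {f}.
Arguments summable0 {R X}.

Section ComplexSums.
Context {R : realType} {X : choiceType}.
Implicit Types h : X -> R[i].

Definition csummable h : Prop :=
  summable_fun (fun x => Re (h x)) /\ summable_fun (fun x => Im (h x)).

Definition csum h : R[i] :=
  (tsum (fun x => Re (h x)) +i* tsum (fun x => Im (h x)))%C.

Lemma csumD h1 h2 : csummable h1 -> csummable h2 ->
  csum (fun x => h1 x + h2 x) = csum h1 + csum h2.
Proof.
move=> [r1 i1] [r2 i2]; rewrite -[csum h1 + _]/(_ +i* _)%C /csum.
congr (_ +i* _)%C; rewrite -[X in X + _]mul1r -tsum_lin //;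
  by congr tsum; apply/funext => x; rewrite mul1r; case: (h1 x) (h2 x) => ? ? [].
Qed.

Lemma csumZ k h : csummable h -> csum (fun x => k * h x) = k * csum h.
Proof.
case: k => a b [sr si]; rewrite -[_ * csum h]/(_ +i* _)%C /csum.
congr (_ +i* _)%C.
  rewrite -mulNr -(tsumZ (- b) si) -(tsum_lin a sr (summableZ _ si)).
  by congr tsum; apply/funext => x; case: (h x) => c d /=; rewrite mulNr.
rewrite -(tsumZ b sr) -(tsum_lin a si (summableZ _ sr)).
by congr tsum; apply/funext => x; case: (h x).
Qed.

Lemma csum_conj h : csummable h -> csum (fun x => (h x)^*) = (csum h)^*.
Proof.
move=> [sr si]; rewrite -[(csum h)^*]/(_ +i* _)%C /csum; congr (_ +i* _)%C.
  by congr tsum; apply/funext => x; case: (h x).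
rewrite -mulN1r -(tsumZ _ si).
by congr tsum; apply/funext => x; case: (h x) => a b /=; rewrite mulN1r.
Qed.

(** The squared modulus as an element of R, since the norm on R[i] takes its values in R[i]. *)
Definition sqn (z : R[i]) : R := Re z ^+ 2 + Im z ^+ 2.

Lemma sqn_ge0 z : 0 <= sqn z.
Proof. by rewrite addr_ge0 ?sqr_ge0. Qed.

Lemma sqn_eq0 z : sqn z = 0 -> z = 0.
Proof.
case: z => a b /eqP; rewrite /sqn paddr_eq0 ?sqr_ge0 //= !sqrf_eq0.
by case/andP => /eqP-> /eqP->.
Qed.

Lemma sqn_lin k z w : sqn (k * z + w) <= 2 * sqn k * sqn z + 2 * sqn w.
Proof.
case: k z w => a b [c d] [e f]; rewrite /sqn /=; rewrite -subr_ge0.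
(* By the parallelogram law the difference of the two sides is |k z - w|^2. *)
rewrite [X in 0 <= X](_ : _ = (a * c - b * d - e) ^+ 2 + (a * d + b * c - f) ^+ 2).
  by rewrite addr_ge0 ?sqr_ge0.
by ring.
Qed.

(** This models l^2 of the complement of [Z] by functions on all of X, so that shifts and cuts need
    no subtype of X. *)
Definition l2_pred (Z : set X) : {pred X -> R[i]} := [pred h |
  `[< (forall x, Z x -> h x = 0) /\ summable_fun (fun x => sqn (h x)) >]].

Lemma l2_predP (Z : set X) h :
  reflect ((forall x, Z x -> h x = 0) /\ summable_fun (fun x => sqn (h x)))
    (h \in l2_pred Z).
Proof. exact: asboolP. Qed.

Lemma l2_submod Z : submod_closed (l2_pred Z).
Proof.
split=> [|k f g /l2_predP[f0 sf] /l2_predP[g0 sg]].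
  apply/l2_predP; split=> //; apply: (@bounded_summable _ _ _ 0) => [x|F].
    exact: sqn_ge0.
  by rewrite /psum big1 // => x _; rewrite /sqn /= !expr0n addr0.
apply/l2_predP; split=> [x Zx|].
  by rewrite -[LHS]/(k * f x + g x) f0 // g0 // mulr0 addr0.
apply: summable_dom (summable_lin (2 * sqn k) sf (summableZ 2 sg)) => x.
by rewrite ger0_norm ?sqn_ge0 //; apply: sqn_lin.
Qed.

End ComplexSums.

(** * The Hilbert space of square-summable functions vanishing on Z *)

Section L2.
Context {R : realType} {X : choiceType} (Z : set X).

Record l2 := L2 { l2_fun :> X -> R[i]; l2_mem : l2_fun \in l2_pred Z }.

HB.instance Definition _ :=
  GRing.isSubmodClosed.Build _ _ (@l2_pred R X Z) (@l2_submod R X Z).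
HB.instance Definition _ := [isSub for l2_fun].
HB.instance Definition _ := [Choice of l2 by <:].
HB.instance Definition _ := [SubChoice_isSubLmodule of l2 by <:].

Implicit Types f g : l2.

Lemma l2P f g : (forall x, f x = g x) -> f = g.
Proof. by move=> e; apply/val_inj/funext. Qed.

Lemma l2D f g x : (f + g) x = f x + g x. Proof. by []. Qed.

Lemma l2B f g x : (f - g) x = f x - g x. Proof. by []. Qed.

Lemma l2Z k f x : (k *: f) x = k * f x. Proof. by []. Qed.

Lemma l20 x : (0 : l2) x = 0. Proof. by []. Qed.

Lemma l2_vanish f x : Z x -> f x = 0.
Proof. by have /l2_predP[+ _] := l2_mem f; apply. Qed.

Lemma l2_summable f : summable_fun (fun x => sqn (f x)).
Proof. by have /l2_predP[] := l2_mem f. Qed.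
Arguments l2_summable : clear implicits.

Definition l2_ip f g : R[i] := csum (fun x => f x * (g x)^*).

Lemma csummable_ip f g : csummable (fun x => f x * (g x)^*).
Proof.
(* |f x|^2 + |g x|^2 dominates both parts of the product. The squares handed to [nra] are instances
   of 2|uv| <= u^2 + v^2. *)
have s := summable_lin 1 (l2_summable f) (l2_summable g).
split; apply: summable_dom s => x; rewrite mul1r;
  case: (f x) (g x) => a b [c d]; rewrite /sqn /= ler_norml.
  have := sqr_ge0 (a - c); have := sqr_ge0 (a + c).
  have := sqr_ge0 (b - d); have := sqr_ge0 (b + d).
  rewrite !sqrrD !sqrrN => *; apply/andP; split; nra.
have := sqr_ge0 (a - d); have := sqr_ge0 (a + d).
have := sqr_ge0 (b - c); have := sqr_ge0 (b + c).
rewrite !sqrrD !sqrrN => *; apply/andP; split; nra.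
Qed.

Lemma l2_ipDl f g h : l2_ip (f + g) h = l2_ip f h + l2_ip g h.
Proof.
rewrite /l2_ip -csumD; try exact: csummable_ip.
by congr csum; apply/funext => x; rewrite l2D mulrDl.
Qed.

Lemma l2_ipZl k f g : l2_ip (k *: f) g = k * l2_ip f g.
Proof.
rewrite /l2_ip -csumZ; last exact: csummable_ip.
by congr csum; apply/funext => x; rewrite l2Z mulrA.
Qed.

Lemma l2_ipC f g : l2_ip g f = (l2_ip f g)^*.
Proof.
rewrite /l2_ip -csum_conj; last exact: csummable_ip.
by congr csum; apply/funext => x; rewrite rmorphM /= conjCK mulrC.
Qed.

Lemma l2_ip_self f : l2_ip f f = (tsum (fun x => sqn (f x)))%:C.
Proof.
rewrite /l2_ip /csum -[RHS]/(_ +i* _)%C; congr (_ +i* _)%C.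
  congr tsum; apply/funext => x; case: (f x) => a b; rewrite /sqn /=.
  by rewrite mulrN opprK !expr2.
rewrite -[RHS](@tsum0 R X); congr tsum; apply/funext => x.
by case: (f x) => a b /=; rewrite mulrN mulrC addNr.
Qed.

Lemma sqn_le_tsum f x : sqn (f x) <= tsum (fun x => sqn (f x)).
Proof.
have := psum_le_tsum [fset x]%fset (fun y => sqn_ge0 (f y)) (l2_summable f).
by rewrite /psum big_seq_fset1.
Qed.

Lemma l2_ip_gt0 f : f != 0 -> 0 < l2_ip f f.
Proof.
move=> f0; rewrite l2_ip_self ltr0c lt_neqAle; apply/andP; split; last first.
  by apply: le_trans (psum_le_tsum fset0 (fun y => sqn_ge0 (f y)) (l2_summable f));
    rewrite /psum big_seq_fset0.
apply: contra_neq f0 => s0; apply: l2P => x; apply: sqn_eq0.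
by apply/eqP; rewrite eq_le sqn_ge0 andbT s0 sqn_le_tsum.
Qed.

Lemma cvg_sum_seq (s : seq X) (u : nat -> X -> R) (v : X -> R) :
  (forall x, (u ^~ x) @ \oo --> v x) ->
  (fun n => \sum_(x <- s) u n x) @ \oo --> \sum_(x <- s) v x.
Proof.
move=> uv; elim: s => [|x s IH].
  by rewrite big_nil; under eq_fun do rewrite big_nil; exact: cvg_cst.
by rewrite big_cons; under eq_fun do rewrite big_cons; apply: cvgD.
Qed.

(** Each coordinate is dominated by the whole sum, so coordinatewise limits exist. As in Fatou's
    lemma, the Cauchy estimate passes to the limit in m on each finite set, with a bound that does
    not depend on that set. *)
Lemma l2_complete (u : nat -> l2) (c : R) : 0 <= c ->
  (forall n m, (n <= m)%N ->
    Re (l2_ip (u n - u m) (u n - u m)) <= (c / 2 ^+ n) ^+ 2) ->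
  exists l, forall n, Re (l2_ip (u n - l) (u n - l)) <= (c / 2 ^+ n) ^+ 2.
Proof.
move=> c0; have cn n : 0 <= c / 2 ^+ n by rewrite divr_ge0 // exprn_ge0.
move=> uc_ip.
have uc n m : (n <= m)%N ->
    tsum (fun x => sqn ((u n - u m) x)) <= (c / 2 ^+ n) ^+ 2.
  by move=> /uc_ip; rewrite l2_ip_self.
have sqn_uc x n m : (n <= m)%N -> sqn (u n x - u m x) <= (c / 2 ^+ n) ^+ 2.
  by move=> nm; apply: le_trans (uc n m nm); apply: (sqn_le_tsum (u n - u m)).
have rate d : 0 < d -> exists n, c / 2 ^+ n < d by exact: exists_half_lt.
have cvgRe x : cvg ((fun n => Re (u n x)) @ \oo).
  apply: (cvg_of_rate rate) => n m /(sqn_uc x) h.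
  rewrite -(@ler_pXn2r _ 2) ?nnegrE ?cn // real_normK ?num_real //.
  by apply: le_trans h; rewrite /sqn raddfB /= lerDl sqr_ge0.
have cvgIm x : cvg ((fun n => Im (u n x)) @ \oo).
  apply: (cvg_of_rate rate) => n m /(sqn_uc x) h.
  rewrite -(@ler_pXn2r _ 2) ?nnegrE ?cn // real_normK ?num_real //.
  by apply: le_trans h; rewrite /sqn !raddfB /= lerDr sqr_ge0.
pose l x := (lim ((fun n => Re (u n x)) @ \oo) +i* lim ((fun n => Im (u n x)) @ \oo))%C.
have psum_l n F : psum (fun x => sqn (u n x - l x)) F <= (c / 2 ^+ n) ^+ 2.
  have ul : (fun m => psum (fun x => sqn (u n x - u m x)) F) @ \oo -->
      psum (fun x => sqn (u n x - l x)) F.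
    apply: cvg_sum_seq => x; rewrite /sqn !raddfB /=.
    under eq_fun do rewrite !raddfB /= !expr2.
    rewrite !expr2; apply: cvgD; apply: cvgM; apply: cvgB;
      by [exact: cvg_cst | exact: cvgRe | exact: cvgIm].
  apply: (cvgr_to_le ul); exists n => // m /= nm.
  apply: le_trans (uc n m nm).
  exact: psum_le_tsum (fun x => sqn_ge0 _) (l2_summable (u n - u m)).
have suml n : summable_fun (fun x => sqn (u n x - l x)).
  by apply: bounded_summable (psum_l n) => x; exact: sqn_ge0.
have lZ : l \in l2_pred Z.
  apply/l2_predP; split=> [x Zx|].
    rewrite /l; have -> : (fun n => Re (u n x)) = cst 0.
      by apply/funext => n; rewrite l2_vanish.
    have -> : (fun n => Im (u n x)) = cst 0.
      by apply/funext => n; rewrite l2_vanish.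
    by rewrite !lim_cst.
  (* Writes l as -(u 0 - l) + u 0 and bounds it by [sqn_lin]. *)
  have s := summable_lin (2 * sqn (-1)) (suml 0%N) (summableZ 2 (l2_summable (u 0%N))).
  apply: summable_dom s => x; rewrite ger0_norm ?sqn_ge0 //.
  rewrite [X in sqn X](_ : _ = -1 * (u 0%N x - l x) + u 0%N x) ?sqn_lin //.
  by rewrite mulN1r opprB subrK.
exists (L2 lZ) => n; rewrite l2_ip_self /=.
exact: tsum_le (suml n) (psum_l n).
Qed.

HB.instance Definition _ := isHilbert.Build R l2
  l2_ipDl l2_ipZl l2_ipC l2_ip_gt0 l2_complete.

Lemma sqr_nrm_l2 f : nrm f ^+ 2 = tsum (fun x => sqn (f x)).
Proof. by rewrite sqr_nrm -[ip f f]/(l2_ip f f) l2_ip_self. Qed.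

End L2.
Arguments l2 R {X} Z.
Arguments l2_summable {R X Z} f.

(** * Kernels of representations are closed *)

Section AutomaticContinuity.
Context {R : realType}.

Section RealNorm.
Context {A : cstarType R}.
Implicit Types x y : A.

Definition rn x : R := Re `|x|.

Lemma rnC x : `|x| = (rn x)%:C. Proof. exact: normC_Re. Qed.

Lemma rn_ge0 x : 0 <= rn x. Proof. exact: Re_normr_ge0. Qed.

Lemma rnD x y : rn (x + y) <= rn x + rn y.
Proof. by rewrite -lecR rmorphD /= -!rnC ler_normD. Qed.

Lemma rnN x : rn (- x) = rn x. Proof. by rewrite /rn normrN. Qed.

Lemma rnB x y : rn (x - y) <= rn x + rn y.
Proof. by rewrite -(rnN y) rnD. Qed.

Lemma rnM x y : rn (x * y) <= rn x * rn y.
Proof. by rewrite -lecR rmorphM /= -!rnC cstar_normM. Qed.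

Lemma rnZ (k : R) x : 0 <= k -> rn (k%:C *: x) = k * rn x.
Proof.
move=> k0; apply: complexI; rewrite -rnC normrZ rmorphM /= -rnC ger0_norm //.
by rewrite ler0c.
Qed.

Lemma rn_eq0 x : rn x = 0 -> x = 0.
Proof. by move=> x0; apply/eqP; rewrite -normr_eq0 rnC x0. Qed.

Lemma rn_le0 x : rn x <= 0 -> x = 0.
Proof. by move=> x0; apply/rn_eq0/eqP; rewrite eq_le x0 rn_ge0. Qed.

Lemma rn_starM x : rn (star x * x) = rn x ^+ 2.
Proof. by apply: complexI; rewrite rmorphXn /= -!rnC; exact: cstar_normE. Qed.

Lemma rn_star_le x : rn x <= rn (star x).
Proof.
have [->|x0] := eqVneq (rn x) 0; first exact: rn_ge0.
have {}x0 : 0 < rn x by rewrite lt_def x0 rn_ge0.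
by rewrite -(ler_pM2r x0) -expr2 -rn_starM rnM.
Qed.

Lemma rn_star x : rn (star x) = rn x.
Proof.
by apply/eqP; rewrite eq_le rn_star_le andbT -{2}(starK x) rn_star_le.
Qed.

Lemma starN x : star (- x) = - star x.
Proof. by rewrite -scaleN1r starZ rmorphN1 scaleN1r. Qed.

Lemma starB x y : star (x - y) = star x - star y.
Proof. by rewrite starD starN. Qed.

Lemma star_mul x y : star (x * y) = star y * star x. Proof. exact: starM. Qed.

Lemma star1 : star (1 : A) = 1.
Proof. by have := star_mul (star 1) 1; rewrite starK !mulr1 starK. Qed.

End RealNorm.

(** * A self-adjoint square root of 1 - h *)

Section SquareRoot.
Context {A : cstarType R} (h : A).
Hypotheses (h_sa : star h = h) (h_small : rn h <= 3 / 4).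

(* A fixed point [y] of [step] satisfies [(1 - y)^2 = 1 - h]. *)
Let step (y : A) : A := (2^-1 : R)%:C *: (h + y * y).
Let y n := iter n step 0.

Let half0 : 0 <= (2^-1 : R). Proof. by rewrite invr_ge0. Qed.

(** The splitting a^2 - b^2 = a(a - b) + (a - b)b holds without commutativity. On the ball of radius
    1/2 it makes [step] a contraction of ratio 1/2. *)
Let step_diff a b : rn (step a - step b) <= 2^-1 * (rn a + rn b) * rn (a - b).
Proof.
have -> : step a - step b = (2^-1 : R)%:C *: (a * (a - b) + (a - b) * b).
  rewrite -scalerBr; congr (_ *: _).
  by rewrite opprD addrACA subrr add0r mulrBr mulrBl addrA subrK.
rewrite rnZ // -mulrA ler_wpM2l // [leRHS]mulrDl (le_trans (rnD _ _)) //.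
by rewrite lerD ?rnM // mulrC rnM.
Qed.

(** The bound 3/4 on [h] is chosen to keep this ball stable: (3/4 + 1/4)/2 = 1/2. *)
Let y_half n : rn (y n) <= 2^-1.
Proof.
elim: n => [|n IH]; first by rewrite /rn normr0.
rewrite /y iterS -/(y n) rnZ //.
have := rnD h (y n * y n); have := rnM (y n) (y n).
have := ler_pM (rn_ge0 _) (rn_ge0 _) IH IH.
have := h_small; lra.
Qed.

Let y_step n : rn (y n - y n.+1) <= (2 ^+ n.+1)^-1.
Proof.
elim: n => [|n IH].
  rewrite /y /= /step mulr0 addr0 sub0r rnN rnZ // expr1; have := rn_ge0 h.
  by have := h_small; lra.
rewrite [X in rn (X - _)]/y iterS -/(y n) [X in rn (_ - X)]/y iterS -/(y n.+1).
apply: le_trans (step_diff _ _) _; rewrite exprS invfM.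
apply: ler_pM IH; [by rewrite !(mulr_ge0, addr_ge0, rn_ge0)|exact: rn_ge0|].
have := y_half n; have := y_half n.+1; lra.
Qed.

(** The exact sum of the bounds in [y_step]; the subtracted tail lets the induction on m - n
    close. *)
Let y_cauchy n m : (n <= m)%N -> rn (y n - y m) <= 1 / 2 ^+ n - 1 / 2 ^+ m.
Proof.
move=> /subnK <-; elim: (m - n)%N => [|k IH]; first by rewrite !subrr /rn normr0.
have := rnD (y n - y (k + n)) (y (k + n) - y (k + n).+1).
rewrite subrKA addSn => /le_trans; apply.
have := y_step (k + n); rewrite exprS invfM.
move: IH; lra.
Qed.

(** The iterates are self-adjoint because [h] is, and the limit inherits this since [star] is
    isometric. The root is 1 - l for the limit l. *)
Lemma exists_sqrt_one_sub : exists2 k : A, star k = k & 1 - h = k * k.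
Proof.
have [|l lP] := @cvg_rate R A y 1.
  move=> n m nm; rewrite rnC lecR (le_trans (y_cauchy nm)) //.
  by rewrite lerBlDr lerDl divr_ge0 // exprn_ge0.
have {}lP n : rn (y n - l) <= 1 / 2 ^+ n by rewrite -lecR -rnC.
have l_sa : star l = l.
  apply/eqP; rewrite -subr_eq0; apply/eqP/rn_le0.
  apply: (@le_half _ _ _ 2) => n; rewrite add0r.
  have y_sa : star (y n) = y n.
    elim: n => [|n IH]; first by rewrite /y /= -(scale0r (0 : A)) starZ conjC0 !scale0r.
    rewrite /y iterS -/(y n) starZ starD h_sa star_mul IH.
    by congr (_ *: _); exact: conjc_real.
  have -> : star l - l = (y n - l) - star (y n - l).
    by rewrite starB y_sa opprB [RHS]addrC addrA subrK.
  have := rnB (y n - l) (star (y n - l)); rewrite rn_star.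
  have := lP n; lra.
have l_le : rn l <= 2.
  have := rnB (y 0%N) (y 0%N - l); rewrite opprB addrC subrK.
  have := lP 0%N; have := y_half 0%N; rewrite expr0; lra.
have l_fix : l = step l.
  apply/eqP; rewrite -subr_eq0; apply/eqP/rn_le0.
  (* A generous constant: [step_diff] with |y n| <= 1/2 and |l| <= 2 contributes 5/4, and the rate
     at n + 1 contributes 1/2. *)
  apply: (@le_half _ _ _ 3) => n; rewrite add0r.
  have -> : l - step l = (step (y n) - step l) - (y n.+1 - l).
    by rewrite -[y n.+1]/(step (y n)) opprB [RHS]addrC subrKA.
  have := rnB (step (y n) - step l) (y n.+1 - l).
  have := step_diff (y n) l; have := lP n; have := lP n.+1; have := y_half n.
  have := rn_ge0 (y n - l); have := rn_ge0 (y n); have := rn_ge0 l.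
  rewrite exprS invfM; nra.
have ll : l + l = h + l * l.
  rewrite {1 2}l_fix -scalerDl -rmorphD.
  have -> : 2^-1 + 2^-1 = 1 :> R by lra.
  by rewrite scale1r.
exists (1 - l); first by rewrite starB star1 l_sa.
have -> : h = l + l - l * l by rewrite ll addrK.
by rewrite mulrBl mul1r mulrBr mulr1 -[RHS]addrA -opprD [in RHS]addrA.
Qed.

End SquareRoot.

(** * Boundedness of representations *)

Section Representation.
Context {A : cstarType R} {H : hilbertType R} (f : {linear A -> opalg H}).
Hypotheses (fM : {morph f : x y / x * y}) (f1 : f 1 = 1).
Hypothesis f_star : {morph f : x / star x >-> star x}.

(* Writing [1 - b^* b = k^* k], one gets [|x|^2 - |f(b) x|^2 = |f(k) x|^2]. *)
Lemma nrm_rep_small (b : A) (x : H) :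
  rn b ^+ 2 <= 3 / 4 -> nrm ((f b : bop H) x) <= nrm x.
Proof.
move=> b_small; have bb_sa : star (star b * b) = star b * b.
  by rewrite star_mul starK.
have [|k k_sa k2] := exists_sqrt_one_sub bb_sa; first by rewrite rn_starM.
have := Re_ip_ge0 ((f k : bop H) x).
have -> : ip ((f k : bop H) x) ((f k : bop H) x) =
    ip x x - ip ((f b : bop H) x) ((f b : bop H) x).
  rewrite !starP -!f_star k_sa -!bopM -!fM -k2 linearB f1 /= -ipBr.
  by congr ip.
rewrite raddfB /= -!sqr_nrm subr_ge0.
by rewrite ler_pXn2r ?nnegrE ?nrm_ge0.
Qed.

(** The factor 2 comes from rescaling [b] to norm 1/2, whose square is below 3/4; any constant would
    do for the closedness of the kernel. *)
Lemma nrm_rep_le (b : A) (x : H) :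
  nrm ((f b : bop H) x) <= 2 * rn b * nrm x.
Proof.
have [b0|b0] := eqVneq (rn b) 0.
  by rewrite (rn_eq0 b0) linear0 nrm0 -(rn_eq0 b0) b0 mulr0 mul0r.
have {}b0 : 0 < rn b by rewrite lt_def b0 rn_ge0.
pose k : R := 2 * rn b; have k0 : 0 < k by rewrite mulr_gt0.
have -> : b = k%:C *: ((k^-1)%:C *: b).
  by rewrite scalerA -rmorphM /= mulfV ?scale1r // gt_eqF.
set c := _ *: b; have rc : rn c = 2^-1.
  by rewrite rnZ ?invr_ge0 ?ltW // /k invfM -mulrA mulVf ?mulr1 // gt_eqF.
rewrite linearZ -[X in nrm X]/(k%:C *: (f c : bop H) x) nrmZ_Re.
have -> : Re `|k%:C : R[i]| = k.
  by rewrite ger0_norm // ler0c ltW.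
rewrite rnZ ?(ltW k0) // rc mulrCA mulfV ?pnatr_eq0 // mulr1.
by rewrite ler_pM2l // nrm_rep_small // rc; lra.
Qed.

Lemma rep_kernel_ideal : is_closed_ideal [set a | f a = 0].
Proof.
split=> /=.
- move=> a a_cl; apply: bopP => x; apply/nrm_eq0/eqP.
  rewrite eq_le nrm_ge0 andbT.
  apply: (@le_half _ _ _ (2 * nrm x)) => n; rewrite add0r.
  have e0 : 0 < ((2 ^+ n)^-1)%:C :> R[i] by rewrite ltr0c invr_gt0 exprn_gt0.
  (* [b] lies in the kernel within 2^-n of [a], so f(a) = f(a - b) is small. *)
  have [b [/= fb]] := a_cl _ (nbhsx_ballx a _ e0).
  rewrite -ball_normE /= rnC ltcR => ab.
  have -> : (f a : bop H) x = (f (a - b) : bop H) x by rewrite linearB fb subr0.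
  apply: le_trans (nrm_rep_le _ _) _; rewrite mulrAC.
  by rewrite ler_wpM2l ?(ltW ab) // mulr_ge0 ?nrm_ge0.
- exact: linear0.
- by move=> k x y x0 y0; rewrite linearP x0 y0 scaler0 addr0.
- by move=> a x x0; rewrite fM x0 mulr0.
- by move=> a x x0; rewrite fM x0 mul0r.
Qed.

End Representation.
End AutomaticContinuity.

(** * The representation by partial shifts *)

Section Polarization.
Context {R : realType} {H : hilbertType R}.

Lemma Re_ip_polar (x y : H) :
  4 * Re (ip x y) = nrm (x + y) ^+ 2 - nrm (x - y) ^+ 2.
Proof.
have yx : Re (ip y x) = Re (ip x y) by rewrite (ipC x y); case: (ip x y).
rewrite !sqr_nrm ipBl ipDl !(ipBr, ipDr) !(raddfB, raddfD) /= yx; lra.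
Qed.

(** Meant for a shift [T] and the projection [P] onto its initial space: the adjoint of a shift is
    then found from norms, without reindexing an infinite sum of products. *)
Lemma ip_eq_of_nrm_eq (T P : H -> H) : linear T -> linear P ->
  (forall x, nrm (T x) = nrm (P x)) ->
  forall x y, ip (T x) (T y) = ip (P x) (P y).
Proof.
move=> lT lP TP x y.
have TD u v : T (u + v) = T u + T v by have := lT 1 u v; rewrite !scale1r.
have PD u v : P (u + v) = P u + P v by have := lP 1 u v; rewrite !scale1r.
have T0 : T 0 = 0 by apply: (addrI (T 0)); rewrite -TD !addr0.
have P0 : P 0 = 0 by apply: (addrI (P 0)); rewrite -PD !addr0.
have TZ k u : T (k *: u) = k *: T u by have := lT k u 0; rewrite T0 !addr0.
have PZ k u : P (k *: u) = k *: P u by have := lP k u 0; rewrite P0 !addr0.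
have TB u v : T (u - v) = T u - T v by rewrite TD -scaleN1r TZ scaleN1r.
have PB u v : P (u - v) = P u - P v by rewrite PD -scaleN1r PZ scaleN1r.
have ReE u v : Re (ip (T u) (T v)) = Re (ip (P u) (P v)).
  have n4 : (4 : R) != 0 by rewrite pnatr_eq0.
  apply: (mulfI n4); rewrite !Re_ip_polar.
  by rewrite -TD -TB -PD -PB !TP.
(* Imaginary parts reduce to real ones by replacing y with iy. *)
have ImE z : Im z = Re (('i%C)^* * z) :> R.
  by case: z => a b /=; rewrite mul0r mulN1r opprK add0r.
apply/eqP; rewrite eq_complex ReE eqxx /= !ImE -!ipZr -TZ -PZ ReE.
exact: eqxx.
Qed.

End Polarization.

(** * Shifts, multiplication by indicators, and their relations *)

Section ShiftRepresentation.
Context {R : realType} {X : choiceType} {G : groupType}.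
Variables (theta : partial_action X G) (Z : set X).
Hypothesis Zinv : Defs.invariant theta Z.

Local Notation D := (dom theta).
Local Notation "g ** x" := (act theta g x) (at level 35).
Local Notation H := (l2 R Z).

Lemma act_domV g y : D g y -> D g^-1%g (g^-1%g ** y).
Proof.
by move=> gy; have [f _ _] := @act_bij X G theta g^-1%g; apply: f; rewrite invgK.
Qed.

Lemma actVK g y : D g y -> g ** (g^-1%g ** y) = y.
Proof.
move=> gy; rewrite actM; first by rewrite mulgV act1.
by split; rewrite invgK // mulgV dom1.
Qed.

Lemma actKV g y : D g^-1%g y -> g^-1%g ** (g ** y) = y.
Proof. by move=> gy; have := @actVK g^-1%g y gy; rewrite invgK. Qed.

Lemma invariantV g y : D g y -> Z y -> Z (g^-1%g ** y).
Proof. by move=> gy Zy; apply: (@Zinv g^-1%g); exists y; rewrite ?invgK. Qed.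

(** On point masses: the one at x goes to the one at [g ** x] if x lies in the domain of g, and to 0
    otherwise. *)
Definition shift (g : G) (f : X -> R[i]) : X -> R[i] :=
  fun y => if `[< D g y >] then f (g^-1%g ** y) else 0.

Definition cut (U : set X) (f : X -> R[i]) : X -> R[i] :=
  fun y => if `[< U y >] then f y else 0.

Lemma sqn0 : sqn (0 : R[i]) = 0.
Proof. by rewrite /sqn /= expr0n addr0. Qed.

(** The action of g^-1 is injective on D_g, so it carries the part of [F] in D_g to a finite set
    over which f has the same sum. *)
Lemma psum_shift_le g (f : H) F :
  psum (fun y => sqn (shift g f y)) F <= tsum (fun y => sqn (f y)).
Proof.
pose F' := [fset y in F | `[< D g y >]]%fset.
have F'D : {in F' &, injective (act theta g^-1%g)}.
  move=> x y; rewrite !inE => /andP[_ /asboolP gx] /andP[_ /asboolP gy] e.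
  by rewrite -(actVK gx) e actVK.
have -> : psum (fun y => sqn (shift g f y)) F =
    psum (fun x => sqn (f x)) [fset (g^-1%g ** y) | y in F']%fset.
  rewrite /psum big_imfset //= big_fset /= [LHS](bigID (fun y => `[< D g y >])) /=.
  rewrite [X in _ + X]big1 ?addr0 => [|y /negbTE gy]; last first.
    by rewrite /shift gy sqn0.
  by apply: eq_bigr => y gy; rewrite /shift gy.
by apply: psum_le_tsum; [move=> x; exact: sqn_ge0 | exact: l2_summable].
Qed.

Lemma shift_mem g (f : H) : shift g f \in l2_pred Z.
Proof.
apply/l2_predP; split=> [y Zy|].
  rewrite /shift; case: asboolP => // gy.
  by rewrite l2_vanish //; apply: invariantV.
by apply: bounded_summable (psum_shift_le g f) => x; exact: sqn_ge0.
Qed.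

Lemma cut_mem U (f : H) : cut U f \in l2_pred Z.
Proof.
apply/l2_predP; split=> [y Zy|].
  by rewrite /cut l2_vanish //; case: ifP.
apply: summable_dom (l2_summable f) => x; rewrite ger0_norm ?sqn_ge0 // /cut.
by case: ifP => // _; rewrite sqn0 sqn_ge0.
Qed.

Definition shiftL g (f : H) : H := L2 (shift_mem g f).
Definition cutL U (f : H) : H := L2 (cut_mem U f).

Lemma shiftL_linear g : linear (shiftL g).
Proof.
move=> k f h; apply: l2P => y; rewrite l2D l2Z /= /shift.
by case: asboolP => _; rewrite ?mulr0 ?addr0.
Qed.

Lemma cutL_linear U : linear (cutL U).
Proof.
move=> k f h; apply: l2P => y; rewrite l2D l2Z /= /cut.
by case: asboolP => _; rewrite ?mulr0 ?addr0.
Qed.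

Lemma nrm_shiftL g f : nrm (shiftL g f) <= nrm f.
Proof.
rewrite -(@ler_pXn2r _ 2) ?nnegrE ?nrm_ge0 // !sqr_nrm_l2.
apply: tsum_le => [|F]; first exact: (l2_summable (shiftL g f)).
exact: psum_shift_le.
Qed.

Lemma shiftLV g f : shiftL g (shiftL g^-1%g f) = cutL (D g) f.
Proof.
apply: l2P => y; rewrite /= /shift /cut; case: asboolP => // gy.
by case: asboolP => [_|[]]; rewrite ?invgK ?actVK //; exact: act_domV.
Qed.

Lemma shiftL_cut g f : shiftL g (cutL (D g^-1%g) f) = shiftL g f.
Proof.
apply: l2P => y; rewrite /= /shift /cut; case: asboolP => // gy.
by case: asboolP => [//|[]]; exact: act_domV.
Qed.

Lemma cut_shiftL g f : cutL (D g) (shiftL g f) = shiftL g f.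
Proof. by apply: l2P => y; rewrite /= /shift /cut; case: asboolP. Qed.

(** Shifts are contractions: the shift of f is the shift of its cut, and shifting back by g^-1
    returns that cut. *)
Lemma nrm_shiftL_cut g f : nrm (shiftL g f) = nrm (cutL (D g^-1%g) f).
Proof.
apply/eqP; rewrite eq_le -{1}shiftL_cut nrm_shiftL /=.
by rewrite -shiftLV invgK nrm_shiftL.
Qed.

Lemma cutL_adj U : adjoint_to (cutL U) (cutL U).
Proof.
move=> f h; congr csum; apply/funext => x; rewrite /= /cut.
by case: asboolP => _; rewrite ?conjC0 ?mulr0 ?mul0r.
Qed.

(** With S_g the shift, and P the cut to D_(g^-1): <S_g f, h> = <S_g f, S_g S_(g^-1) h> = <P f, P
    S_(g^-1) h> = <f, S_(g^-1) h>. The middle equality is polarization. *)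
Lemma shiftL_adj g : adjoint_to (shiftL g) (shiftL g^-1%g).
Proof.
move=> f h; rewrite -cut_shiftL cutL_adj -shiftLV.
rewrite (ip_eq_of_nrm_eq (@shiftL_linear g) (@cutL_linear (D g^-1%g))).
  by rewrite cutL_adj !cut_shiftL.
exact: nrm_shiftL_cut.
Qed.

Lemma shiftL_adjointable g : shiftL g \in @adjointable R H.
Proof.
apply/adjointableP; exists (shiftL g^-1%g); split; first exact: shiftL_adj.
by exists 1 => // f; rewrite mul1r nrm_shiftL.
Qed.

Lemma cutL_adjointable U : cutL U \in @adjointable R H.
Proof.
apply/adjointableP; exists (cutL U); split; first exact: cutL_adj.
exists 1 => // f; rewrite mul1r.
rewrite -(@ler_pXn2r _ 2) ?nnegrE ?nrm_ge0 // !sqr_nrm_l2.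
apply: tsum_le => [|F]; first exact: (l2_summable (cutL U f)).
apply: le_trans (psum_le_tsum F (fun x => sqn_ge0 _) (l2_summable f)).
apply: ler_sum => x _; rewrite /= /cut; case: ifP => // _.
by rewrite sqn0 sqn_ge0.
Qed.

Definition shift_op g : opalg H := Bop (shiftL_adjointable g).
Definition cut_op U : opalg H := Bop (cutL_adjointable U).

Lemma star_shift_op g : star (shift_op g) = shift_op g^-1%g.
Proof. by apply: star_uniq; exact: shiftL_adj. Qed.

Lemma range_proj_shift g : range_proj shift_op g = cut_op (D g).
Proof.
by rewrite /range_proj star_shift_op; apply: bopP => f; exact: shiftLV.
Qed.

Lemma star_cut_op U : star (cut_op U) = cut_op U.
Proof. by apply: star_uniq; exact: cutL_adj. Qed.

Lemma cut_opM U V : cut_op U * cut_op V = cut_op (U `&` V).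
Proof.
apply: bopP => f; apply: l2P => x; rewrite /= /cut asbool_and.
by case: asboolP => //; case: asboolP.
Qed.

Lemma cut_opT : cut_op setT = 1.
Proof.
by apply: bopP => f; apply: l2P => x; rewrite /= /cut; case: asboolP => // [[]].
Qed.

Lemma cut_opC U : cut_op (~` U) = 1 - cut_op U.
Proof.
apply: bopP => f; apply: l2P => x; rewrite bopB l2B /= /cut asbool_neg.
by case: asboolP => _ /=; rewrite ?subrr ?subr0.
Qed.

Lemma cut_opU U V : cut_op (U `|` V) = cut_op U + cut_op V - cut_op U * cut_op V.
Proof.
apply: bopP => f; apply: l2P => x.
rewrite bopB bopD l2B l2D cut_opM /= /cut asbool_or asbool_and.
by do 2 case: asboolP => _ /=; rewrite ?subr0 ?addr0 ?add0r ?addrK.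
Qed.

(** By [act_dom] both sides produce functions supported in the intersection of D_h and D_(hi), where
    [actM] makes them agree. *)
Lemma shift_opM h i : shift_op h * shift_op i =
  shift_op h * star (shift_op h) * shift_op (h * i)%g.
Proof.
rewrite -/(range_proj shift_op h) range_proj_shift.
apply: bopP => f; apply: l2P => y; rewrite /= /cut /shift.
case: asboolP => // hy.
have hiP : D i (h^-1%g ** y) <-> D (h * i)%g y.
  have /seteqP[s1 s2] := @act_dom X G theta h i; split=> [iy|hiy].
    have /s1[] : (act theta h @` (D i `&` D h^-1%g)) y.
      by exists (h^-1%g ** y); [split=> //; exact: act_domV | exact: actVK].
    by [].
  have [x [ix hx] <-] : (act theta h @` (D i `&` D h^-1%g)) y by apply: s2.
  by rewrite actKV.
rewrite (asbool_equiv_eq hiP); case: asboolP => // hiy.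
by rewrite actM ?invgM // !invgK.
Qed.

Lemma cut_extends : extends_to_boolean_hom theta shift_op cut_op.
Proof.
split.
- move=> U UA; split.
  + pose F := [set V | cstar_generated (range (range_proj shift_op)) (cut_op V)].
    suff FB : is_set_boolean_algebra F.
      apply: (UA F); split=> // _ [g _ <-] M [_]; apply.
      by exists g => //; rewrite range_proj_shift.
    (* The generated subalgebra contains the unit, as the range projection of the neutral element;
       complements need it. *)
    have F1 : F setT.
      by move=> M [_]; apply; exists 1%g; rewrite // range_proj_shift dom1.
    have FI V W : F V -> F W -> F (V `&` W).
      move=> FV FW M CM; rewrite -cut_opM.
      by have [[_ _ _ MM _] _] := CM; apply: MM; [exact: FV|exact: FW].
    have FC V : F V -> F (~` V).
      move=> FV M CM; rewrite cut_opC addrC -scaleN1r -cut_opT.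
      by have [[_ _ ML _ _] _] := CM; apply: ML; [exact: FV|exact: F1].
    split=> // V W FV FW.
    by rewrite -(setCK (V `|` W)) setCU; exact: FC (FI _ _ (FC _ FV) (FC _ FW)).
  + exact: star_cut_op.
  + by rewrite cut_opM setIid.
- by move=> g; rewrite range_proj_shift.
- by move=> U V _ _; rewrite cut_opM.
- by move=> U V _ _; rewrite cut_opU.
- by move=> U _; rewrite cut_opC.
Qed.

Lemma shift_relations : satisfies_relations theta shift_op.
Proof.
split.
- move=> g; rewrite /is_partial_isometry -/(range_proj shift_op g).
  by rewrite range_proj_shift; apply: bopP => f; exact: cut_shiftL.
- by move=> g h; rewrite !range_proj_shift !cut_opM setIC.
- apply: bopP => f; apply: l2P => x; rewrite /= /shift dom1.
  by case: asboolP => [_|[//]]; rewrite invg1 act1.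
- by move=> g; rewrite star_shift_op.
- exact: shift_opM.
- by exists cut_op; exact: cut_extends.
Qed.

Lemma cut_op_eq0 (U : set X) : cut_op U = 0 -> U `<=` Z.
Proof.
move=> U0 x Ux; apply: contrapT => nZx.
(* The point mass at [x] belongs to the space because [x] is not in [Z], and [cut_op U] fixes it. *)
pose d (y : X) : R[i] := (y == x)%:R.
have dl2 : d \in l2_pred Z.
  apply/l2_predP; split=> [y Zy|].
    by rewrite /d; case: eqP => // yx; case: nZx; rewrite -yx.
  apply: (@bounded_summable _ _ _ 1) => [y|F]; first exact: sqn_ge0.
  rewrite /psum; have [xF|xF] := boolP (x \in F).
    rewrite (big_fsetD1 x) //= big_seq big1 => [|y]; last first.
      by rewrite !inE => /andP[/negbTE yx _]; rewrite /d yx sqn0.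
    by rewrite addr0 /d eqxx /sqn /= expr1n expr0n addr0.
  rewrite big_seq big1 ?ler01 // => y yF.
  by rewrite /d; case: eqP yF xF => [->->|_ _ _] //; rewrite sqn0.
have := congr1 (fun T : bop H => (T (L2 dl2) : X -> R[i]) x) U0.
rewrite bop0 l20 /= /cut; case: asboolP => // _; rewrite /d eqxx.
by move/eqP; rewrite oner_eq0.
Qed.

End ShiftRepresentation.

(** * Generated ideals and injectivity *)

Lemma smallest_sub (T : Type) (C : set (set T)) (S M : set T) :
  C M -> S `<=` M -> smallest C S `<=` M.
Proof. by move=> CM SM x; apply. Qed.

Section Ideals.
Context {R : realType} {A : cstarType R}.

Lemma ideal_generated_ideal (S : set A) : is_closed_ideal (ideal_generated S).
Proof.
split.
- by apply: closed_bigI => I [[]].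
- by move=> I [[]].
- move=> k x y Ix Iy I /[dup] SI [[_ _ IL _ _] _].
  by apply: IL; [exact: Ix|exact: Iy].
- by move=> a x Ix I /[dup] SI [[_ _ _ IM _] _]; apply: IM; exact: Ix.
- by move=> a x Ix I /[dup] SI [[_ _ _ _ IM] _]; apply: IM; exact: Ix.
Qed.

End Ideals.

Section Injectivity.
Context {R : realType} {X : choiceType} {G : groupType}.
Context (theta : partial_action X G) {A : cstarType R} (s : G -> A).
Hypothesis hA : is_universal_cstar theta s.
Context (phi : set X -> A) (hphi : extends_to_boolean_hom theta s phi).

Lemma boolean_hom_uniq (B : cstarType R) (t : G -> B) (psi : set X -> B)
    (f : {linear A -> B}) : extends_to_boolean_hom theta t psi ->
  {morph f : x y / x * y} -> {morph f : x / star x >-> star x} -> f 1 = 1 ->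
  (forall g, f (s g) = t g) ->
  (* Both sides are Boolean homomorphisms that agree on the generators D_g. *)
  forall U, domain_algebra theta U -> f (phi U) = psi U.
Proof.
move=> hpsi fM f_star f1 fs U UA.
pose F := [set V | domain_algebra theta V /\ f (phi V) = psi V].
(* Membership in the domain algebra is carried along in [F], because the laws of [phi] and [psi]
   hold only there. *)
suff FB : is_set_boolean_algebra F.
  have [] // : F U; apply: (UA F); split=> // _ [g _ <-]; split.
    by move=> M [_]; apply; exists g.
  rewrite (bool_hom_dom hphi) (bool_hom_dom hpsi) /range_proj fM.
  by rewrite f_star fs.
have FI V W : F V -> F W -> F (V `&` W).
  move=> [AV eV] [AW eW]; split.
    by move=> M CM; have [[_ MI _ _] _] := CM; apply: MI; [exact: AV|exact: AW].
  by rewrite (bool_homI hphi) // (bool_homI hpsi) // fM eV eW.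
have FC V : F V -> F (~` V).
  move=> [AV eV]; split.
    by move=> M CM; have [[_ _ _ MC] _] := CM; apply: MC; exact: AV.
  by rewrite (bool_homC hphi) // (bool_homC hpsi) // linearB f1 eV.
split=> //.
  have e : setT = dom theta 1%g by rewrite dom1.
  split; first by move=> M [_]; apply; exists 1%g; rewrite ?e.
  rewrite e (bool_hom_dom hphi) (bool_hom_dom hpsi) /range_proj fM.
  by rewrite f_star fs.
move=> V W FV FW.
by rewrite -(setCK (V `|` W)) setCU; exact: FC (FI _ _ (FC _ FV) (FC _ FW)).
Qed.

(** Reflecting inclusions rather than equalities yields injectivity by exchanging [Y] and [Z]. *)
Lemma ideal_of_reflects (Y Z : set X) :
  admissible theta Y -> Defs.invariant theta Z ->
  ideal_of theta phi Y `<=` ideal_of theta phi Z -> Y `<=` Z.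
Proof.
move=> Yadm Zinv YZ.
have [f [fM f_star fs]] := univ_map hA (@shift_relations R X G theta Z Zinv).
have f1 : f 1 = 1.
  rewrite -(rel_one (univ_rel hA)) fs.
  exact: rel_one (@shift_relations R X G theta Z Zinv).
have fphi := boolean_hom_uniq (cut_extends Zinv) fM f_star f1 fs.
have kerZ : ideal_of theta phi Z `<=` [set a | f a = 0].
  apply: smallest_sub; first exact: rep_kernel_ideal.
  move=> _ [U [UA UZ] <-] /=; rewrite fphi //.
  apply: bopP => v; apply: l2P => x; rewrite bop0 l20 /= /cut.
  by case: asboolP => // /UZ Zx; rewrite l2_vanish.
rewrite Yadm => x [U [UA UY] Ux]; apply: (@cut_op_eq0 R X Z U) => //.
rewrite -fphi //; apply: kerZ; apply: YZ => I [_]; apply.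
by exists U.
Qed.

End Injectivity.

Theorem theorem8p5 (R : realType) (X : Type) (G : groupType)
    (theta : partial_action X G) (A : cstarType R) (s : G -> A)
    (hA : is_universal_cstar theta s)
    (phi : set X -> A) (hphi : extends_to_boolean_hom theta s phi) :
  [/\ set_fun (invariant_admissible theta) (@is_closed_ideal R A)
        (ideal_of theta phi),
      set_inj (invariant_admissible theta) (ideal_of theta phi)
    & forall Y Z : set X,
        invariant_admissible theta Y -> invariant_admissible theta Z ->
        Y `<=` Z -> ideal_of theta phi Y `<=` ideal_of theta phi Z].
Proof.
(* Finite sums and point masses need a choice structure on the bare type [X]; [{classic X}] supplies
   it. *)
have inj := @ideal_of_reflects R {classic X} G theta A s hA phi hphi.
split=> [Y _|Y Z|Y Z _ _ YZ].
- exact: ideal_generated_ideal.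
- move=> /set_mem[Yinv Yadm] /set_mem[Zinv Zadm] e.
  by apply/seteqP; split; apply: inj => //; rewrite e.
- apply: smallest_sub; first exact: ideal_generated_ideal.
  by move=> _ [U [UA UY] <-] I [_]; apply; exists U => //; split=> // x /UY /YZ.
Qed.
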